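(* Let $r\in\mathbb{N}$, $n=2r+1$, $\mu,\nu\in\mathbb{R}$, $\nu\neq0$, and let $\mathfrak{J}_{(\mu,\nu)}^{n-1}$ be the $n$-dimensional real Lie algebra with basis $e_1,\ldots,e_n$ and non-zero commutation relations \[ [e_1,e_n]=\mu e_1-\nu e_2,\quad [e_2,e_n]=\nu e_1+\mu e_2, \] \[ [e_{2k-1},e_n]=\mu e_{2k-1}-\nu e_{2k}+e_{2k-3},\quad [e_{2k},e_n]=\nu e_{2k-1}+\mu e_{2k}+e_{2k-2},\quad k=2,\ldots,r. \] Then a basis of $\mathrm{Inv}(\mathfrak{J}_{(\mu,\nu)}^{n-1})$ is given by $\zeta_1$ if $r=1$, and by $\zeta_1,\zeta_3,\zeta_4,\ldots,\zeta_{2r}$ if $r\geqslant2$, where \[ \zeta_1=(e_1^2+e_2^2)\exp\Bigl(-2\frac\mu\nu\arctan\frac{e_2}{e_1}\Bigr), \] \[ \zeta_3=\nu\frac{e_1e_3+e_2e_4}{e_1^2+e_2^2}-\arctan\frac{e_2}{e_1},\qquad \zeta_4=\frac{e_1e_4-e_2e_3}{e_1^2+e_2^2}, \] \[ \zeta_{2k-1}=\frac{e_1\hat\zeta_{2k-1}+e_2\hat\zeta_{2k}}{e_1^2+e_2^2},\qquad \zeta_{2k}=\frac{e_2\hat\zeta_{2k-1}-e_1\hat\zeta_{2k}}{e_1^2+e_2^2},\quad k=3,\ldots,r, \] with \[ \hat\zeta_{2k-1}=\sum_{j=1}^k\left(-\frac{e_1e_3+e_2e_4}{e_1^2+e_2^2}\right)^{k-j}\frac{e_{2j-1}}{(k-j)!},\qquad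 \hat\zeta_{2k}=\sum_{j=1}^k\left(-\frac{e_1e_3+e_2e_4}{e_1^2+e_2^2}\right)^{k-j}\frac{e_{2j}}{(k-j)!}. \]
   Context: For a finite-dimensional real Lie algebra $\mathfrak{g}$ with basis $e_1,\ldots,e_n$, $[e_i,e_j]=c_{ij}^ke_k$, let $x_1,\ldots,x_n$ be the coordinates on $\mathfrak{g}^*$ associated with the dual basis. An invariant of the coadjoint action is a (possibly only locally defined, on a connected open set) smooth function $F(x_1,\ldots,x_n)$ invariant under the coadjoint action, equivalently $\sum_{j,k}c_{ij}^kx_k\,\partial F/\partial x_j=0$ for all $i$. The maximal number of functionally independent invariants is $N_\mathfrak{g}=\dim\mathfrak{g}-\sup_x\operatorname{rank}(\sum_k c_{ij}^kx_k)_{i,j}$. A basis of invariants is a set of $N_\mathfrak{g}$ functionally independent invariants (every invariant is then locally a function of them). Elements of $\mathrm{Inv}(\mathfrak{g})$ (generalized Casimir operators) are obtained from invariants by replacing $x_i$ by $e_i$ (with symmetrization of non-commuting products); here only the mutually commuting elements $e_1,\ldots,e_{n-1}$ occur, so $e_i$ may simply be read as the coordinate $x_i$. *)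

(* Defs.v *)
From HB Require Import structures.
From mathcomp Require Import all_boot all_order all_algebra.
From mathcomp Require Import all_classical all_reals all_analysis.

Set Implicit Arguments.
Unset Strict Implicit.
Unset Printing Implicit Defensive.

Import Order.TTheory GRing.Theory Num.Theory.
Import numFieldNormedType.Exports.

Local Open Scope classical_set_scope.
Local Open Scope ring_scope.

Section LieAlgebra.
Variables (R : realType) (g : vectType R).
Implicit Type br : g -> g -> g.

Definition lie_bracket br :=
  [/\ forall x, linear (br x),
      forall y, linear (br^~ y),
      forall x, br x x = 0
    & forall x y z, br (br x y) z + br (br y z) x + br (br z x) y = 0].

Section Invariants.
Variables (n : nat) (br : g -> g -> g) (e : n.-tuple g).

Definition struct_const (i j k : 'I_n) : R := coord e k (br e`_i e`_j).

(* A point of the dual of g is given by the row vector x of its values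
   x 0 k on the basis vectors e`_k. *)
Definition coadjoint_mx (x : 'rV[R]_n) : 'M[R]_n :=
  \matrix_(i, j) \sum_k struct_const i j k * x 0 k.

(* The ranks are bounded by n, so their supremum is the largest k <= n which
   is attained. *)
Definition max_coadjoint_rank : nat :=
  \max_(k < n.+1 | `[< exists x, \rank (coadjoint_mx x) = k >]) k.

Definition invariants_number : nat := (n - max_coadjoint_rank)%N.

End Invariants.
End LieAlgebra.

Section Smoothness.
Variables (R : realType) (n : nat).
Implicit Types (F : 'rV[R]_n -> R) (U : set 'rV[R]_n).

Definition partial (i : 'I_n) F : 'rV[R]_n -> R := 'D_(delta_mx 0 i) F.

Definition iter_partial (s : seq 'I_n) F : 'rV[R]_n -> R := foldr partial F s.

(* U is meant to be open: the functions are total, but only their values on U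
   then matter. *)
Definition smooth_on U F :=
  forall (s : seq 'I_n) x, U x ->
    {for x, continuous (iter_partial s F)} /\
    forall i : 'I_n, derivable (iter_partial s F) x (delta_mx 0 i).

End Smoothness.

Section FunctionalIndependence.
Variables (R : realType) (n : nat).
Implicit Types (U V : set 'rV[R]_n) (s : seq ('rV[R]_n -> R)).

Definition tuple_map s (x : 'rV[R]_n) : 'rV[R]_(size s) :=
  \row_(i < size s) nth (fun=> 0) s i x.

(* The functions of s are dependent on U if, locally around every point of U,
   they satisfy a relation H = 0 with H smooth and not identically zero on any
   nonempty open set; they are independent on U if they are dependent on no
   nonempty open subset of U (Olver, Applications of Lie Groups to Differential
   Equations, Section 2.1). *)
Definition functionally_dependent U s :=
  forall x, U x ->
  exists (V : set 'rV[R]_n) (H : 'rV[R]_(size s) -> R),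
    [/\ open V, V x & V `<=` U] /\
    [/\ smooth_on setT H,
        forall W, open W -> W !=set0 -> exists2 z, W z & H z != 0
      & forall y, V y -> H (tuple_map s y) = 0].

Definition functionally_independent U s :=
  forall V, open V -> V !=set0 -> V `<=` U -> ~ functionally_dependent V s.

End FunctionalIndependence.

Section BasisOfInvariants.
Variables (R : realType) (g : vectType R) (n : nat).
Variables (br : g -> g -> g) (e : n.-tuple g).

Definition coadjoint_invariant (U : set 'rV[R]_n) (F : 'rV[R]_n -> R) :=
  smooth_on U F /\
  forall x, U x -> forall i : 'I_n,
    \sum_j \sum_k struct_const br e i j k * x 0 k * partial j F x = 0.

Definition basis_of_invariants (U : set 'rV[R]_n) (s : seq ('rV[R]_n -> R)) :=
  [/\ size s = invariants_number br e,
      forall i, (i < size s)%N -> coadjoint_invariant U (nth (fun=> 0) s i)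
    & functionally_independent U s].

End BasisOfInvariants.

(* The basis e_1, ..., e_n is numbered from 1, whereas sequences and row
   vectors are indexed from 0. The commutation relations which are not listed,
   other than those obtained by antisymmetry, are zero. *)
Definition J_relations (R : realType) (g : vectType R) (br : g -> g -> g)
    (r : nat) (mu nu : R) (e : (2 * r).+1.-tuple g) :=
  let E i := e`_i.-1 in
  let n := (2 * r).+1 in
  [/\ br (E 1%N) (E n) = mu *: E 1%N - nu *: E 2%N,
      br (E 2%N) (E n) = nu *: E 1%N + mu *: E 2%N,
      forall k, (2 <= k <= r)%N ->
        br (E (2 * k - 1)%N) (E n) =
          mu *: E (2 * k - 1)%N - nu *: E (2 * k)%N + E (2 * k - 3)%N /\
        br (E (2 * k)%N) (E n) =
          nu *: E (2 * k - 1)%N + mu *: E (2 * k)%N + E (2 * k - 2)%N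
    & forall i j, (1 <= i < n)%N -> (1 <= j < n)%N -> br (E i) (E j) = 0].

Section Zeta.
Variables (R : realType) (m : nat) (mu nu : R).
Implicit Types (x : 'rV[R]_m.+1) (k : nat).

Definition crd x (i : nat) : R := x 0 (inord i.-1).

Definition zeta1 x : R :=
  (crd x 1 ^+ 2 + crd x 2 ^+ 2) *
  expR (- 2 * (mu / nu) * atan (crd x 2 / crd x 1)).

Definition zeta3 x : R :=
  nu * ((crd x 1 * crd x 3 + crd x 2 * crd x 4) /
        (crd x 1 ^+ 2 + crd x 2 ^+ 2))
  - atan (crd x 2 / crd x 1).

Definition zeta4 x : R :=
  (crd x 1 * crd x 4 - crd x 2 * crd x 3) / (crd x 1 ^+ 2 + crd x 2 ^+ 2).

Definition hat_coef x : R :=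
  - ((crd x 1 * crd x 3 + crd x 2 * crd x 4) /
     (crd x 1 ^+ 2 + crd x 2 ^+ 2)).

Definition hat_odd k x : R :=
  \sum_(1 <= j < k.+1)
    hat_coef x ^+ (k - j) * (crd x (2 * j - 1) / ((k - j)`!)%:R).

Definition hat_even k x : R :=
  \sum_(1 <= j < k.+1)
    hat_coef x ^+ (k - j) * (crd x (2 * j) / ((k - j)`!)%:R).

(* zeta_(2k-1) and zeta_(2k) for k >= 3 *)
Definition zeta_odd k x : R :=
  (crd x 1 * hat_odd k x + crd x 2 * hat_even k x) /
  (crd x 1 ^+ 2 + crd x 2 ^+ 2).

Definition zeta_even k x : R :=
  (crd x 2 * hat_odd k x - crd x 1 * hat_even k x) /
  (crd x 1 ^+ 2 + crd x 2 ^+ 2).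

(* only used for i = 1 and i >= 3 *)
Definition zeta (i : nat) : 'rV[R]_m.+1 -> R :=
  if i == 1%N then zeta1
  else if i == 3%N then zeta3
  else if i == 4%N then zeta4
  else if odd i then zeta_odd i.+1./2
  else zeta_even i./2.

End Zeta.

Definition zeta_seq (R : realType) (r : nat) (mu nu : R) :
    seq ('rV[R]_(2 * r).+1 -> R) :=
  if r == 1%N then [:: zeta mu nu 1]
  else zeta mu nu 1 :: [seq zeta mu nu i | i <- index_iota 3 (2 * r).+1].

(* Main.v *)
Require Import Defs.
From mathcomp Require Import all_boot all_order all_algebra.
From mathcomp Require Import all_classical all_reals all_analysis.
From mathcomp Require Import ring lra zify.
Import Order.TTheory GRing.Theory Num.Theory.
Import numFieldNormedType.Exports.
Local Open Scope classical_set_scope.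
Local Open Scope ring_scope.

(* Put z_k = x_(2k-1) + i x_(2k). The coadjoint action is generated by multiples
   of the partial derivative in x_n, which kills every zeta, and by the field
   z_1' = (mu + i nu) z_1, z_k' = (mu + i nu) z_k + z_(k-1). The ratios
   w_k = z_k / z_1 then satisfy w_1' = 0 and w_k' = w_(k-1), i.e. they evolve by
   the exponential of a nilpotent shift, with Re w_2 as time; applying
   exp (- Re w_2 N) gives invariants, and these are zeta_4, zeta_5, ... up to
   sign. zeta_1 and zeta_3 compare log |z_1| and Re w_2 with the angle of z_1,
   which grows at the rate nu.
   For independence, near a point a the map (zeta_1, zeta_3, zeta_4, ...) has an
   explicit continuous right inverse through a: keep the angle of z_1, read
   |z_1| off zeta_1 and the time t = Re w_2 off zeta_3, and apply exp (t N) to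
   the prescribed invariants. So the image of a neighbourhood of a contains an
   open set, on which no admissible relation H can vanish. *)

(** * Directional derivatives and elementary functions *)

Section DirectionalDerivatives.
Context {R : realType} {V : normedModType R}.
Implicit Types (f : V -> R) (x v : V).

(** Only derivability along [v] is assumed of [f], so the chain rule is reduced to one variable by
    restricting to the line [h *: v + x]. *)
Lemma is_derive_comp f (g : R -> R) x v df dg :
  is_derive x v f df -> is_derive (f x) 1 g dg ->
  is_derive x v (g \o f) (df * dg).
Proof.
case=> fd fE; case=> gd gE.
pose F (h : R) : R := f (h *: v + x).
have F0 : F 0 = f x by rewrite /F scale0r add0r.
have Fd : derivable F 0 1 by case: (derivable1P f x v) => + _; exact.
have Dline (k : V -> R) :
    'D_v k x = (fun h : R => k (h *: v + x))^`()%classic 0.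
  rewrite derive1E /derive; set q1 := fun h => h^-1 *: _.
  set q2 := fun h => h^-1 *: _; suff -> : q1 = q2 by [].
  by apply/funext => h; rewrite /q1 /q2 /= addr0 scale0r add0r [_%:A]mulr1.
have gFd : derivable g (F 0) 1 by rewrite F0.
split.
  apply/derivable1P/derivable1_diffP.
  by apply: (@differentiable_comp _ _ _ _ F); exact/derivable1_diffP.
rewrite Dline -[LHS]/((g \o F)^`()%classic 0) derive1_comp // F0 derive1E gE.
by rewrite -Dline fE mulrC.
Qed.

Lemma is_derive_inv f x v df : f x != 0 -> is_derive x v f df ->
  is_derive x v (fun y => (f y)^-1) (- (f x ^- 2) * df).
Proof.
by move=> fx0 [fd <-]; split; [exact: derivableV|rewrite deriveV].
Qed.

Lemma is_derive_big_sum (I : eqType) (s : seq I) (h : I -> V -> R)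
    (dh : I -> R) x v :
  (forall i, i \in s -> is_derive x v (h i) (dh i)) ->
  is_derive x v (fun y => \sum_(i <- s) h i y) (\sum_(i <- s) dh i).
Proof.
elim: s => [|i s IHs] hs.
  rewrite big_nil; under eq_fun do rewrite big_nil.
  exact: is_derive_cst.
rewrite big_cons; under eq_fun do rewrite big_cons.
apply: is_deriveD; first by apply: hs; rewrite mem_head.
by apply: IHs => j js; apply: hs; rewrite in_cons js orbT.
Qed.

(* Logarithmic derivatives: the common term [c * a] cancels in a quotient. *)
Lemma is_derive_div_weighted f g x v (a b c : R) : g x != 0 ->
  is_derive x v f (c * (a * f x + b)) -> is_derive x v g (c * (a * g x)) ->
  is_derive x v (fun y => f y / g y) (c * (b / g x)).
Proof.
move=> gx0 df dg.
apply: is_derive_eq; first exact: is_deriveM df (is_derive_inv _ _ _ _ gx0 dg).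
by rewrite /GRing.scale /=; field.
Qed.

End DirectionalDerivatives.

Lemma is_derive_coord (R : realType) n (x v : 'rV[R]_n) i :
  is_derive x v (fun y : 'rV[R]_n => y 0 i) (v 0 i).
Proof.
split; first exact/diff_derivable/differentiable_coord.
have := @derive_mx _ _ _ _ (@id 'rV[R]_n) x v (@derivable_id _ _ x v).
by rewrite derive_id => /matrixP/(_ 0 i); rewrite mxE => <-.
Qed.

(** * Elementary functions and their smoothness *)

Section Elementary.
Context {R : realType} {n : nat}.
Implicit Types (F G : 'rV[R]_n -> R) (U : set 'rV[R]_n).

(** Members are differentiable on [U], and directional derivatives stay in the class up to equality
    on [U]; smoothness then follows by iteration. *)
Inductive elementary U : ('rV[R]_n -> R) -> Prop :=
| elementary_cst c : elementary U (fun=> c)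
| elementary_coord i : elementary U (fun x => x 0 i)
| elementaryD F G :
    elementary U F -> elementary U G -> elementary U (fun x => F x + G x)
| elementaryM F G :
    elementary U F -> elementary U G -> elementary U (fun x => F x * G x)
| elementaryV F : (forall x, U x -> F x != 0) ->
    elementary U F -> elementary U (fun x => (F x)^-1)
| elementary_expR F : elementary U F -> elementary U (fun x => expR (F x))
| elementary_atan F : elementary U F -> elementary U (fun x => atan (F x)).

Lemma elementaryN U F : elementary U F -> elementary U (fun x => - F x).
Proof.
move=> Fel; under eq_fun do rewrite -mulN1r.
by apply: elementaryM => //; exact: elementary_cst.
Qed.

Lemma elementaryB U F G :
  elementary U F -> elementary U G -> elementary U (fun x => F x - G x).
Proof. by move=> Fel Gel; apply: elementaryD => //; exact: elementaryN. Qed.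

Lemma elementaryX U F m : elementary U F -> elementary U (fun x => F x ^+ m).
Proof.
move=> Fel; elim: m => [|m IHm]; first exact: elementary_cst.
by under eq_fun do rewrite exprS; exact: elementaryM.
Qed.

Lemma elementary_sum U (I : Type) (s : seq I) (F : I -> 'rV[R]_n -> R) :
  (forall i, elementary U (F i)) -> elementary U (fun x => \sum_(i <- s) F i x).
Proof.
move=> Fel; elim: s => [|i s IHs].
  by under eq_fun do rewrite big_nil; exact: elementary_cst.
by under eq_fun do rewrite big_cons; exact: elementaryD.
Qed.

Lemma elementary_differentiable U F :
  elementary U F -> forall x, U x -> differentiable F x.
Proof.
elim=> {F} [c|i|F G _ IF _ IG|F G _ IF _ IG|F F0 _ IF|F _ IF|F _ IF] x Ux.
- exact: differentiable_cst.
- exact: differentiable_coord.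
- exact: differentiableD (IF x Ux) (IG x Ux).
- exact: differentiableM (IF x Ux) (IG x Ux).
- by apply: differentiableV; [exact: IF|exact: F0].
- apply: (@differentiable_comp _ _ _ _ F) => //; first exact: IF.
  exact/derivable1_diffP/derivable_expR.
- apply: (@differentiable_comp _ _ _ _ F) => //; first exact: IF.
  by apply/derivable1_diffP; case: (is_derive1_atan (F x)).
Qed.

Lemma elementary_derive U F v : elementary U F ->
  exists2 G, elementary U G & forall x, U x -> 'D_v F x = G x.
Proof.
have der H x : elementary U H -> U x -> is_derive x v H ('D_v H x).
  move=> Hel Ux; apply/derivableP/diff_derivable.
  exact: elementary_differentiable Ux.
elim=> {F} [c|i|F G Fel [F' F'el DF] Gel [G' G'el DG]
           |F G Fel [F' F'el DF] Gel [G' G'el DG]|F F0 Fel [F' F'el DF]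
           |F Fel [F' F'el DF]|F Fel [F' F'el DF]].
- exists (fun=> 0); first exact: elementary_cst.
  by move=> x _; exact: derive_cst.
- exists (fun=> v 0 i); first exact: elementary_cst.
  by move=> x _; have [] := is_derive_coord _ _ x v i.
- exists (fun x => F' x + G' x); first exact: elementaryD.
  by move=> x Ux; rewrite -DF // -DG //; apply: deriveD;
    exact/diff_derivable/(@elementary_differentiable U).
- exists (fun x => F x * G' x + G x * F' x).
    by apply: elementaryD; exact: elementaryM.
  by move=> x Ux; rewrite -DF // -DG //; apply: deriveM;
    exact/diff_derivable/(@elementary_differentiable U).
- exists (fun x => - ((F x)^-1 ^+ 2) * F' x).
    apply: elementaryM => //; apply/elementaryN/elementaryX.
    exact: elementaryV.
  move=> x Ux; have [_ ->] := is_derive_inv _ _ _ _ (F0 x Ux) (der F x Fel Ux).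
  by rewrite DF // exprVn.
- exists (fun x => F' x * expR (F x)).
    by apply: elementaryM => //; exact: elementary_expR.
  move=> x Ux; rewrite -DF //.
  by have [_ ->] := is_derive_comp _ _ _ _ _ _ (der F x Fel Ux)
    (is_derive_expR (F x)).
- exists (fun x => F' x * (1 + F x ^+ 2)^-1).
    apply: elementaryM => //; apply: elementaryV.
      by move=> x _; rewrite gt_eqF // ltr_wpDr // sqr_ge0.
    by apply: elementaryD; [exact: elementary_cst|exact: elementaryX].
  move=> x Ux; rewrite -DF //.
  by have [_ ->] := is_derive_comp _ _ _ _ _ _ (der F x Fel Ux)
    (is_derive1_atan (F x)).
Qed.

Lemma elementary_smooth U F : open U -> elementary U F -> smooth_on U F.
Proof.
move=> Uop Fel s.
have [G Gel FG] : exists2 G, elementary U G &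
    forall x, U x -> iter_partial s F x = G x.
  elim: s => [|i s [G Gel FG]]; first by exists F.
  have [G' G'el DG] := elementary_derive _ _ (delta_mx 0 i) Gel.
  (* Since [U] is open, the equality on [U] holds near [x] and may be differentiated. *)
  exists G' => // x Ux; rewrite -DG //; apply: near_eq_derive.
  by apply: filterS FG _; exact: open_nbhs_nbhs.
move=> x Ux.
have FGx : \forall y \near x, G y = iter_partial s F y.
  have : nbhs x U by exact: open_nbhs_nbhs.
  by apply: filterS => y Uy; rewrite FG.
have Gd := elementary_differentiable U G Gel x Ux.
split=> [|i]; last first.
  by apply: (near_eq_derivable FGx); exact: diff_derivable.
have /= := differentiable_continuous Gd.
rewrite /prop_for /continuous_at FG // => Gc.
exact: cvg_trans (near_eq_cvg FGx) Gc.
Qed.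

End Elementary.

(** * Invariance *)

Section ExponentialShift.
Context {R : realType}.
Implicit Types (s t : R) (u : nat -> R) (k : nat).

(* [exp (t N)] applied to the sequence [u_1, u_2, ...], where [N] is the shift
   [u_k |-> u_(k-1)], [u_1 |-> 0]. *)
Definition exp_shift t u k : R :=
  \sum_(1 <= j < k.+1) t ^+ (k - j) * (u j / ((k - j)`!)%:R).

Lemma eq_exp_shift t u1 u2 k :
  (forall j, (0 < j <= k)%N -> u1 j = u2 j) ->
  exp_shift t u1 k = exp_shift t u2 k.
Proof. by move=> u12; apply: eq_big_nat => j jk; rewrite u12. Qed.

Lemma exp_shift0 u k : (0 < k)%N -> exp_shift 0 u k = u k.
Proof.
move=> k0; rewrite /exp_shift big_nat_recr //= subnn expr0 mul1r divr1.
rewrite big_nat big1 ?add0r // => j /andP[_ jk].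
by rewrite expr0n subn_eq0 leqNgt jk mul0r.
Qed.

Lemma exp_shift_1 t u : exp_shift t u 1 = u 1%N.
Proof. by rewrite /exp_shift big_nat1 subnn expr0 divr1 mul1r. Qed.

Lemma exp_shift_2 t u : exp_shift t u 2 = t * u 1%N + u 2%N.
Proof.
rewrite /exp_shift big_nat_recr //= big_nat1 subnn subSnn expr0 expr1 /=.
by rewrite !divr1 mul1r.
Qed.

(** The binomial theorem for the divided powers [t ^+ i / i!]. *)
Lemma exprD_fact s t m :
  \sum_(i < m.+1) s ^+ (m - i) / ((m - i)`!)%:R * (t ^+ i / (i`!)%:R) =
  (s + t) ^+ m / (m`!)%:R.
Proof.
rewrite exprDn mulr_suml; apply: eq_bigr => i _.
have im : (i <= m)%N by rewrite -ltnS.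
have f0 j : (j`!)%:R != 0 :> R by rewrite pnatr_eq0 -lt0n fact_gt0.
rewrite -(bin_fact im) !natrM -mulr_natr.
have b0 : 'C(m, i)%:R != 0 :> R by rewrite pnatr_eq0 -lt0n bin_gt0.
by field; rewrite !f0 b0.
Qed.

(** The group law exp (s N) exp (t N) = exp ((s + t) N): after exchanging the sums, the coefficient
    of each [u i] is a binomial sum. *)
Lemma exp_shiftD s t u k :
  exp_shift s (exp_shift t u) k = exp_shift (s + t) u k.
Proof.
rewrite /exp_shift.
transitivity (\sum_(1 <= j < k.+1) \sum_(1 <= i < k.+1 | (i < j.+1)%N)
    s ^+ (k - j) / ((k - j)`!)%:R * (t ^+ (j - i) / ((j - i)`!)%:R) * u i).
  apply: eq_big_nat => j /andP[_ jk].
  rewrite -(big_nat_widen _ _ _ xpredT _ jk) mulr_suml mulr_sumr.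
  by apply: eq_bigr => i _; ring.
rewrite (exchange_big_dep_nat xpredT) //=.
apply: eq_big_nat => i /andP[i0 ik].
transitivity (\sum_(i <= j < k.+1)
    s ^+ (k - j) / ((k - j)`!)%:R * (t ^+ (j - i) / ((j - i)`!)%:R) * u i).
  rewrite [RHS](big_nat_widenl _ 1) //.
rewrite -mulr_suml -{1}[i]add0n big_addn subSn // big_mkord.
rewrite [u i / _]mulrC mulrA -exprD_fact; congr (_ * _).
apply: eq_bigr => j _.
by rewrite addnK addnC subnDA.
Qed.

(** If u' = c N u and t' = - c, then exp (t N) u is stationary: the derivatives of the summands
    telescope. *)
Lemma is_derive_exp_shift {V : normedModType R} (x v : V) (t : V -> R)
    (u : nat -> V -> R) (c : R) k :
  is_derive x v t (- c) ->
  (forall j, (0 < j <= k)%N ->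
    is_derive x v (u j) (c * (if j is j'.+2 then u j'.+1 x else 0))) ->
  is_derive x v (fun y => exp_shift (t y) (u^~ y) k) 0.
Proof.
move=> dt du.
pose w j := if j is j'.+2 then u j'.+1 x else 0.
have {}du j : (0 < j <= k)%N -> is_derive x v (u j) (c * w j) by exact: du.
have wS j : (0 < j)%N -> w j.+1 = u j x by case: j.
have w1 : w 1%N = 0 by [].
(* With [w j] = u_(j-1), the j-th summand has derivative [c * (B j - B j.+1)]. The end terms vanish:
   [B 1] because [w 1 = 0], and [B k.+1] by the cut-off at [k]. *)
clearbody w; pose B j :=
  if (j <= k)%N then t x ^+ (k - j) * (w j / ((k - j)`!)%:R) else 0.
have -> : 0 = \sum_(1 <= j < k.+1) c * (B j - B j.+1).
  rewrite -mulr_sumr; under eq_bigr do rewrite -opprB.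
  rewrite sumrN telescope_sumr // /B ltnn w1 mul0r mulr0 if_same.
  by rewrite subr0 oppr0 mulr0.
apply: is_derive_big_sum => j; rewrite mem_index_iota ltnS => /andP[j0 jk].
apply: is_derive_eq.
  apply: is_deriveM; first by rewrite -exprfctE; exact: is_deriveX.
  apply: is_deriveM; first by apply: du; rewrite j0.
have f0 l : (l`!)%:R != 0 :> R by rewrite pnatr_eq0 -lt0n fact_gt0.
rewrite /B jk /GRing.scale /=.
have [kj|jk'] := ltnP j k; last first.
  have -> : j = k by apply/eqP; rewrite eqn_leq jk.
  by rewrite subnn /= fact0 invr1; ring.
rewrite wS //.
have -> : (k - j = (k - j.+1).+1)%N by lia.
rewrite factS natrM /= exprS.
by field; rewrite f0 nat1r pnatr_eq0.
Qed.

Lemma elementary_exp_shift {n} (U : set 'rV[R]_n) (t : 'rV[R]_n -> R)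
    (u : nat -> 'rV[R]_n -> R) k :
  elementary U t -> (forall j, elementary U (u j)) ->
  elementary U (fun x => exp_shift (t x) (u^~ x) k).
Proof.
move=> tel uel; apply: elementary_sum => j; apply: elementaryM.
  exact: elementaryX.
by apply: elementaryM => //; exact: elementary_cst.
Qed.

End ExponentialShift.

(** * The ratios z_k / z_1 and the zetas expressed by them *)

Section Ratios.
Context {R : realType} {m : nat}.
Implicit Types (x : 'rV[R]_m.+1) (k : nat).

(* With z_k := x_(2k-1) + i x_(2k), these are Re (z_k / z_1), Im (z_k / z_1)
   and |z_1|^2. *)
Definition re_ratio k x : R :=
  (crd x 1 * crd x (2 * k - 1) + crd x 2 * crd x (2 * k)) /
  (crd x 1 ^+ 2 + crd x 2 ^+ 2).

Definition im_ratio k x : R :=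
  (crd x 1 * crd x (2 * k) - crd x 2 * crd x (2 * k - 1)) /
  (crd x 1 ^+ 2 + crd x 2 ^+ 2).

Definition sqr_mod x : R := crd x 1 ^+ 2 + crd x 2 ^+ 2.

Lemma sqr_mod_gt0 x : crd x 1 != 0 -> 0 < sqr_mod x.
Proof.
by move=> x1; rewrite /sqr_mod ltr_pwDl ?sqr_ge0 // exprn_even_gt0.
Qed.

Lemma re_ratio1 x : crd x 1 != 0 -> re_ratio 1 x = 1.
Proof.
by move=> x1; rewrite /re_ratio /= -!expr2 divff // gt_eqF ?sqr_mod_gt0.
Qed.

Lemma im_ratio1 x : im_ratio 1 x = 0.
Proof. by rewrite /im_ratio /= [crd x 2 * _]mulrC subrr mul0r. Qed.

(** Division by z_1 commutes with the shift, so this is the real part of exp (- Re w_2 N) w. Where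
    x_1 is nonzero its value at k = 2 is - Re w_2 + Re w_2 = 0, hence the separate formula for
    zeta_3. *)
Lemma zeta_oddE k :
  zeta_odd k = fun x => exp_shift (- re_ratio 2 x) (re_ratio^~ x) k.
Proof.
apply/funext => x.
rewrite /zeta_odd /hat_odd /hat_even !mulr_sumr -big_split /= mulr_suml.
by apply: eq_bigr => j _; rewrite /hat_coef -/(re_ratio 2 x) /re_ratio; ring.
Qed.

(** The sign reflects the order of the two products in [zeta_even]; [zeta4] has the opposite
    convention. *)
Lemma zeta_evenE k :
  zeta_even k = fun x => - exp_shift (- re_ratio 2 x) (im_ratio^~ x) k.
Proof.
apply/funext => x.
rewrite /zeta_even /hat_odd /hat_even !mulr_sumr -sumrB mulr_suml -sumrN.
by apply: eq_bigr => j _; rewrite /hat_coef -/(re_ratio 2 x) /im_ratio; ring.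
Qed.

Lemma zetaE (mu nu : R) i :
  zeta (m := m) mu nu (2 * i.+3 - 1) = zeta_odd i.+3 /\
  zeta (m := m) mu nu (2 * i.+3) = zeta_even i.+3.
Proof.
have [-> ->] : (2 * i.+3 - 1 = (i.*2).+4.+1 /\ 2 * i.+3 = (i.*2).+4.+2)%N.
  by lia.
by rewrite /zeta /= odd_double uphalf_double doubleK.
Qed.

Lemma zeta_ind (mu nu : R) r (P : ('rV[R]_m.+1 -> R) -> Prop) :
  P (zeta1 mu nu) -> ((1 < r)%N -> P (zeta3 nu)) ->
  ((1 < r)%N -> P (@zeta4 R m)) ->
  (forall k, (2 < k <= r)%N -> P (zeta_odd k) /\ P (zeta_even k)) ->
  forall i, (i == 1%N) || (2 < i < (2 * r).+1)%N -> P (zeta mu nu i).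
Proof.
move=> P1 P3 P4 Pk i; case/orP => [/eqP-> //|/andP[i2 ir]].
rewrite /zeta ifF; last by lia.
case: eqP => [|i3]; first by move=> i3; apply: P3; lia.
case: eqP => [|i4]; first by move=> i4; apply: P4; lia.
by case: ifP => io; [apply: (Pk _ _).1|apply: (Pk _ _).2]; lia.
Qed.

End Ratios.

(** * Smoothness of the zetas where x_1 is nonzero *)

Section Smoothness.
Context {R : realType} {m : nat}.
Variables (U : set 'rV[R]_m.+1).
Hypothesis U1 : U `<=` [set x | crd x 1 != 0].

Let elementary_crd i : elementary U (fun x => crd x i).
Proof. exact: elementary_coord. Qed.

Let elementary_sqr_modV : elementary U (fun x => (sqr_mod x)^-1).
Proof.
apply: elementaryV => [x /U1 x1|]; first by rewrite gt_eqF // sqr_mod_gt0.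
by apply: elementaryD; exact: elementaryX.
Qed.

Let elementary_arg : elementary U (fun x => atan (crd x 2 / crd x 1)).
Proof. by apply/elementary_atan/elementaryM => //; apply: elementaryV. Qed.

Lemma elementary_re_ratio k : elementary U (re_ratio k).
Proof.
by apply: elementaryM => //; apply: elementaryD; exact: elementaryM.
Qed.

Lemma elementary_im_ratio k : elementary U (im_ratio k).
Proof.
by apply: elementaryM => //; apply: elementaryB; exact: elementaryM.
Qed.

Lemma elementary_zeta (mu nu : R) i :
  (i == 1%N) || (2 < i)%N -> elementary U (zeta mu nu i).
Proof.
(* Taking [r := i] makes the upper bound on the index automatic. *)
move=> i1; apply: (@zeta_ind _ _ mu nu i (elementary U)); last by lia.
- apply: elementaryM; first by apply: elementaryD; exact: elementaryX.
  apply: elementary_expR; apply: elementaryM => //; exact: elementary_cst.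
- move=> _; apply: elementaryB => //; apply: elementaryM.
    exact: elementary_cst.
  exact: (elementary_re_ratio 2).
- by move=> _; exact: (elementary_im_ratio 2).
- move=> k _; split.
    rewrite zeta_oddE; apply: elementary_exp_shift.
      exact/elementaryN/elementary_re_ratio.
    exact: elementary_re_ratio.
  rewrite zeta_evenE; apply/elementaryN/elementary_exp_shift.
    exact/elementaryN/elementary_re_ratio.
  exact: elementary_im_ratio.
Qed.

End Smoothness.

(** * Derivatives of the zetas along the coadjoint fields *)

Section Invariance.
Context {R : realType} {m : nat}.
Variables (r : nat) (mu nu c : R) (x v : 'rV[R]_m.+1).
Hypothesis nu0 : nu != 0.
Hypothesis x1 : crd x 1 != 0.

(* [v] is [c] times the vector field z_1' = (mu + i nu) z_1,
   z_k' = (mu + i nu) z_k + z_(k-1). *)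
Hypothesis v1 : crd v 1 = c * (mu * crd x 1 - nu * crd x 2).
Hypothesis v2 : crd v 2 = c * (nu * crd x 1 + mu * crd x 2).
Hypothesis vk : forall k, (2 <= k <= r)%N ->
  crd v (2 * k - 1) = c * (mu * crd x (2 * k - 1) - nu * crd x (2 * k)
    + crd x (2 * k - 3)) /\
  crd v (2 * k) = c * (nu * crd x (2 * k - 1) + mu * crd x (2 * k)
    + crd x (2 * k - 2)).

Let is_derive_crd i : is_derive x v (fun y => crd y i) (crd v i).
Proof. exact: is_derive_coord. Qed.

Let is_derive_sqr_mod :
  is_derive x v sqr_mod (c * ((2 * mu) * sqr_mod x)).
Proof.
apply: is_derive_eq.
  by apply: is_deriveD; rewrite -exprfctE; exact: is_deriveX.
by rewrite /GRing.scale /= v1 v2 /sqr_mod; ring.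
Qed.

(** In z_k times the conjugate of z_1 the rotation [nu] cancels. Its growth rate is that of |z_1|^2,
    up to a source term with z_(k-1), so only the source survives in the quotient. *)
Let is_derive_re_ratio k : (0 < k <= r)%N ->
  is_derive x v (re_ratio k)
    (c * (if k is k'.+2 then re_ratio k'.+1 x else 0)).
Proof.
have s0 := gt_eqF (sqr_mod_gt0 x x1).
case: k => [//|[_|k kr]].
  rewrite -{1}[0](mul0r (sqr_mod x)^-1).
  apply: (is_derive_div_weighted _ _ _ _ (2 * mu)) => //; first by rewrite s0.
  apply: is_derive_eq.
    by apply: is_deriveD; exact: is_deriveM.
  by rewrite /GRing.scale /= v1 v2; ring.
apply: (is_derive_div_weighted _ _ _ _ (2 * mu)) => //; first by rewrite s0.
apply: is_derive_eq.
  by apply: is_deriveD; exact: is_deriveM.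
have [-> ->] := vk k.+2 ltac:(lia).
have -> : (2 * k.+2 - 3 = 2 * k.+1 - 1)%N by lia.
have -> : (2 * k.+2 - 2 = 2 * k.+1)%N by lia.
by rewrite /GRing.scale /= v1 v2; ring.
Qed.

Let is_derive_im_ratio k : (0 < k <= r)%N ->
  is_derive x v (im_ratio k)
    (c * (if k is k'.+2 then im_ratio k'.+1 x else 0)).
Proof.
have s0 := gt_eqF (sqr_mod_gt0 x x1).
case: k => [//|[_|k kr]].
  rewrite -{1}[0](mul0r (sqr_mod x)^-1).
  apply: (is_derive_div_weighted _ _ _ _ (2 * mu)) => //; first by rewrite s0.
  apply: is_derive_eq.
    by apply: is_deriveB; exact: is_deriveM.
  by rewrite /GRing.scale /= v1 v2; ring.
apply: (is_derive_div_weighted _ _ _ _ (2 * mu)) => //; first by rewrite s0.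
apply: is_derive_eq.
  by apply: is_deriveB; exact: is_deriveM.
have [-> ->] := vk k.+2 ltac:(lia).
have -> : (2 * k.+2 - 3 = 2 * k.+1 - 1)%N by lia.
have -> : (2 * k.+2 - 2 = 2 * k.+1)%N by lia.
by rewrite /GRing.scale /= v1 v2; ring.
Qed.

Let is_derive_arg : is_derive x v (fun y => atan (crd y 2 / crd y 1)) (c * nu).
Proof.
apply: is_derive_eq.
  apply: (is_derive_comp (fun y => crd y 2 / crd y 1) atan).
  apply: is_deriveM (is_derive_crd 2) _.
  exact: is_derive_inv _ _ _ _ x1 (is_derive_crd 1).
have := gt_eqF (sqr_mod_gt0 x x1); rewrite /sqr_mod => /negbT s0.
rewrite /GRing.scale /= v1 v2; field.
by rewrite x1.
Qed.

(** One statement serves every coadjoint field: [c = -1] is the case of e_n, and [c = 0] that of the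
    other basis vectors. *)
Lemma is_derive_zeta i : (i == 1%N) || (2 < i < (2 * r).+1)%N ->
  is_derive x v (zeta mu nu i) 0.
Proof.
apply: (@zeta_ind _ _ mu nu r (fun F => is_derive x v F 0)).
- rewrite /zeta1; move eqa : (-2 * (mu / nu)) => a.
  (* The exponent decreases along the flow exactly as fast as log |z_1|^2 increases. *)
  have amu : 2 * mu = - (a * nu) by rewrite -eqa; field.
  apply: is_derive_eq.
    apply: is_deriveM is_derive_sqr_mod _.
    apply: (is_derive_comp (fun y => a * atan (crd y 2 / crd y 1)) expR).
    exact: is_deriveM (is_derive_cst _ _ _) is_derive_arg.
  by rewrite /GRing.scale /= amu /cst; ring.
- move=> r1; apply: is_derive_eq.
    apply: is_deriveB _ is_derive_arg.
    apply: is_deriveM (is_derive_cst _ _ _) (is_derive_re_ratio 2 _).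
    by lia.
  by rewrite /GRing.scale /= re_ratio1 // /cst; ring.
- move=> r1; apply: is_derive_eq.
    by apply: (is_derive_im_ratio 2); lia.
  by rewrite /= im_ratio1 mulr0.
move=> k /andP[k2 kr].
have dt : is_derive x v (fun y => - re_ratio 2 y) (- c).
  apply: is_derive_eq; first by apply/is_deriveN/(is_derive_re_ratio 2); lia.
  by rewrite /= re_ratio1 // mulr1.
split.
  rewrite zeta_oddE.
  apply: (is_derive_exp_shift _ _ _ _ _ _ dt) => j /andP[j0 jk].
  by apply: is_derive_re_ratio; lia.
rewrite zeta_evenE -oppr0; apply/is_deriveN.
apply: (is_derive_exp_shift _ _ _ _ _ _ dt) => j /andP[j0 jk].
by apply: is_derive_im_ratio; lia.
Qed.

End Invariance.

(** * Functional independence *)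

Lemma continuous_at_mx (R : realType) (T : topologicalType) m n
    (f : T -> 'M[R]_(m, n)) (t : T) :
  (forall i j, {for t, continuous (fun s => f s i j)}) -> {for t, continuous f}.
Proof.
move=> fc A [P fP PA].
have : \forall s \near t, forall i j, P i j (f s i j).
  apply: filter_forall => i; apply: filter_forall => j.
  exact: fc (fP i j).
by apply: filterS => s Ps; exact: PA.
Qed.

(** By continuity [G] maps a neighbourhood of [tuple_map s a] into any given neighbourhood of [a].
    Each [z] there equals [tuple_map s (G z)], so a relation [H] would vanish on a nonempty open
    set. *)
Lemma functionally_independent_section (R : realType) n
    (s : seq ('rV[R]_n -> R)) (U : set 'rV[R]_n) :
  (forall a, U a -> exists G : 'rV[R]_(size s) -> 'rV[R]_n,
    [/\ {for tuple_map s a, continuous G}, G (tuple_map s a) = a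
      & \forall z \near tuple_map s a, tuple_map s (G z) = z]) ->
  functionally_independent U s.
Proof.
move=> Usec V Vop [a Va] VU /(_ a Va)[W [H [[Wop Wa WV] [_ H0 HW]]]].
have [G [Gc Ga GK]] := Usec a (VU a Va).
have GW : \forall z \near tuple_map s a, W (G z).
  by apply: Gc; rewrite Ga; exact: open_nbhs_nbhs.
have : nbhs (tuple_map s a) [set z | H z = 0].
  near=> z.
  have zE : tuple_map s (G z) = z by near: z.
  by rewrite /= -zE; apply: HW; near: z.
rewrite nbhsE => -[Q [Qop Qa] Q0].
have [z Qz] := H0 Q Qop (ex_intro _ _ Qa).
by rewrite (Q0 z Qz) eqxx.
Unshelve. all: by end_near. Qed.

Section Ratios.
Context {R : realType} {m : nat}.
Implicit Types (x : 'rV[R]_m.+1).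

(** Real and imaginary parts of z_k = z_1 w_k. *)
Lemma crd_ratios k x : crd x 1 != 0 ->
  crd x (2 * k - 1) = crd x 1 * re_ratio k x - crd x 2 * im_ratio k x /\
  crd x (2 * k) = crd x 1 * im_ratio k x + crd x 2 * re_ratio k x.
Proof.
move=> x1; have /negbT := gt_eqF (sqr_mod_gt0 x x1); rewrite /sqr_mod => s0.
by rewrite /re_ratio /im_ratio; split; field.
Qed.

Lemma ratios_crd k x p q : crd x 1 != 0 ->
  crd x (2 * k - 1) = crd x 1 * p - crd x 2 * q ->
  crd x (2 * k) = crd x 1 * q + crd x 2 * p ->
  re_ratio k x = p /\ im_ratio k x = q.
Proof.
move=> x1; have /negbT := gt_eqF (sqr_mod_gt0 x x1); rewrite /sqr_mod => s0.
by rewrite /re_ratio /im_ratio => -> ->; split; field.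
Qed.

End Ratios.

(** * A continuous right inverse of the zeta map *)

Section ZetaSection.
Context {R : realType} {r : nat}.
Variables (mu nu : R) (a : 'rV[R]_(2 * r).+1).
Hypothesis nu0 : nu != 0.
Hypothesis r0 : (0 < r)%N.
Hypothesis a1 : crd a 1 != 0.

Let theta := atan (crd a 2 / crd a 1).

(* The sequence [w 0], [w 1], [w 2], ... prescribes the values of zeta_1, zeta_3,
   zeta_4, ... Keeping the polar angle of [a], it determines the scaling of
   (x_1, x_2), the time Re (z_2 / z_1), and the real and imaginary parts of the
   flow-invariant ratios. *)
Definition scale_of (w : nat -> R) : R := Num.sqrt (w 0%N / zeta1 mu nu a).
Definition shift_of (w : nat -> R) : R := (w 1%N + theta) / nu.
(** As [w 0] stands for zeta_1 and [w i] for zeta_(i+2) when i > 0, index [2 * k' + 3] is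
    zeta_(2k-1) with k = k' + 3. The value 1 at k = 1 is z_1 / z_1, and 0 at k = 2 is Re w_2 flowed
    back to time 0. *)
Definition re_of (w : nat -> R) k : R :=
  if k is k'.+3 then w (2 * k' + 3)%N else (k == 1%N)%:R.
(** The minus sign undoes the one in [zeta_evenE]. *)
Definition im_of (w : nat -> R) k : R :=
  if k is k'.+3 then - w (2 * k' + 4)%N else if k == 2%N then w 2%N else 0.

(* [i] is 0-based: even [i] are the x_(2k-1), odd [i] the x_(2k), k = i./2.+1. *)
Definition unit_coord (w : nat -> R) (i : nat) : R :=
  let p := exp_shift (shift_of w) (re_of w) i./2.+1 in
  let q := exp_shift (shift_of w) (im_of w) i./2.+1 in
  if odd i then crd a 1 * q + crd a 2 * p else crd a 1 * p - crd a 2 * q.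

(** The last coordinate, on which no member of [zeta_seq] depends, is copied from [a]. *)
Definition zeta_section (w : nat -> R) : 'rV[R]_(2 * r).+1 :=
  \row_i (if (i < 2 * r)%N then scale_of w * unit_coord w i else a 0 i).

Lemma crd_zeta_section w k : (0 < k <= r)%N ->
  let p := exp_shift (shift_of w) (re_of w) k in
  let q := exp_shift (shift_of w) (im_of w) k in
  crd (zeta_section w) (2 * k - 1) =
    scale_of w * (crd a 1 * p - crd a 2 * q) /\
  crd (zeta_section w) (2 * k) = scale_of w * (crd a 1 * q + crd a 2 * p).
Proof.
case: k => [//|k] kr p q; rewrite /crd !mxE !inordK; try by lia.
have -> : ((2 * k.+1 - 1).-1 = k.*2)%N by lia.
have -> : ((2 * k.+1).-1 = k.*2.+1)%N by lia.
rewrite /unit_coord /= odd_double uphalf_double doubleK.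
by rewrite !ifT //; lia.
Qed.

Let exp_shift_re1 t w : exp_shift t (re_of w) 1 = 1.
Proof. by rewrite exp_shift_1. Qed.

Let exp_shift_im1 t w : exp_shift t (im_of w) 1 = 0.
Proof. by rewrite exp_shift_1. Qed.

Let exp_shift_re2 t w : exp_shift t (re_of w) 2 = t.
Proof. by rewrite exp_shift_2 mulr1 addr0. Qed.

Let exp_shift_im2 t w : exp_shift t (im_of w) 2 = w 2%N.
Proof. by rewrite exp_shift_2 mulr0 add0r. Qed.

Lemma zeta1_gt0 : 0 < zeta1 mu nu a.
Proof. by rewrite mulr_gt0 ?expR_gt0 // sqr_mod_gt0. Qed.

(** Positivity of [w 0] keeps z_1 nonzero and lets the square root be squared back. The index skips
    zeta_2. *)
Lemma zeta_zeta_section w i : 0 < w 0%N -> (i < 2 * r - 1)%N ->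
  zeta mu nu (if i == 0%N then 1%N else i.+2) (zeta_section w) = w i.
Proof.
move=> w0 ir; set x := zeta_section w.
have s0 : 0 < scale_of w by rewrite sqrtr_gt0 divr_gt0 // zeta1_gt0.
have [x1 x2] : crd x 1 = scale_of w * crd a 1 /\ crd x 2 = scale_of w * crd a 2.
  have [] := crd_zeta_section w 1; first by lia.
  by rewrite exp_shift_re1 exp_shift_im1 !mulr1 !mulr0 subr0 add0r.
have x10 : crd x 1 != 0 by rewrite x1 mulf_neq0 // gt_eqF.
have ratio k : (0 < k <= r)%N ->
    re_ratio k x = exp_shift (shift_of w) (re_of w) k /\
    im_ratio k x = exp_shift (shift_of w) (im_of w) k.
  move=> /(crd_zeta_section w) [xo xe]; apply: ratios_crd => //.
    by rewrite xo x1 x2; ring.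
  by rewrite xe x1 x2; ring.
(* Rescaling z_1 by a positive number keeps its angle. *)
have arg : atan (crd x 2 / crd x 1) = theta.
  by rewrite x1 x2 -mulf_div divff ?mul1r // gt_eqF.
case: i ir => [|[|[|i]]] ir /=.
- rewrite /zeta /= /zeta1 arg x1 x2 !exprMn -mulrDr /scale_of.
  rewrite sqr_sqrtr ?divr_ge0 ?ltW ?zeta1_gt0 // -mulrA.
  by rewrite -[X in _ * X]/(zeta1 mu nu a) divfK // gt_eqF ?zeta1_gt0.
- rewrite /zeta /= /zeta3 arg -/(re_ratio 2 x) (ratio 2%N _).1 ?exp_shift_re2.
    by rewrite /shift_of; field.
  by lia.
- rewrite /zeta /= /zeta4 -/(im_ratio 2 x) (ratio 2%N _).2 ?exp_shift_im2 //.
  by lia.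
have r2 : (2 <= r)%N by lia.
(* The time Re w_2 of the new point is [shift_of w], so flowing back by it recovers the prescribed
   invariants. *)
have E u v k : (2 < k <= r)%N ->
    (forall j, (0 < j <= k)%N -> v j = exp_shift (shift_of w) u j) ->
    exp_shift (- re_ratio 2 x) v k = u k.
  move=> kr vE; rewrite (eq_exp_shift _ _ _ _ vE) exp_shiftD.
  by rewrite (ratio 2%N _).1 // exp_shift_re2 addNr exp_shift0 //; lia.
have [io|ie] := boolP (odd i).
  have -> : i.+3.+2 = (2 * i./2.+3)%N by lia.
  rewrite (zetaE _ _ _).2 zeta_evenE (E (im_of w)); last 2 first.
  - by lia.
  - by move=> j jk; rewrite (ratio j _).2 //; lia.
  by rewrite /im_of opprK; congr w; lia.
have -> : i.+3.+2 = (2 * i./2.+3 - 1)%N by lia.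
rewrite (zetaE _ _ _).1 zeta_oddE (E (re_of w)); last 2 first.
- by lia.
- by move=> j jk; rewrite (ratio j _).1 //; lia.
by rewrite /re_of; congr w; lia.
Qed.

(** With the values taken at [a], the scale is 1 and the time is Re w_2 at [a], so flowing forward
    undoes the backward flow in the zetas. *)
Lemma zeta_sectionK w :
  (forall i, (i < 2 * r - 1)%N ->
    w i = zeta mu nu (if i == 0%N then 1%N else i.+2) a) ->
  zeta_section w = a.
Proof.
move=> wE.
have s1 : scale_of w = 1.
  by rewrite /scale_of wE /=; [rewrite divff ?sqrtr1 // gt_eqF ?zeta1_gt0|lia].
have t2 : (1 < r)%N -> shift_of w = re_ratio 2 a.
  move=> r1; rewrite /shift_of wE /=; last by lia.
  by rewrite /zeta /= /zeta3 -/theta subrK -/(re_ratio 2 a) mulrC mulKf.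
have ratio k : (0 < k <= r)%N ->
    exp_shift (shift_of w) (re_of w) k = re_ratio k a /\
    exp_shift (shift_of w) (im_of w) k = im_ratio k a.
  (* For r = 1 there is no zeta_3 and [shift_of w] is not determined, but the first term of
     [exp_shift] does not depend on the time. *)
  move=> kr; have [k1|k2] := leqP k 1.
    have -> : k = 1%N by lia.
    by rewrite exp_shift_re1 exp_shift_im1 re_ratio1 // im_ratio1.
  have r2 : (1 < r)%N by lia.
  suff E j : (0 < j <= k)%N ->
      re_of w j = exp_shift (- re_ratio 2 a) (re_ratio^~ a) j /\
      im_of w j = exp_shift (- re_ratio 2 a) (im_ratio^~ a) j.
    rewrite (eq_exp_shift _ _ _ _ (fun j jk => (E j jk).1)).
    rewrite (eq_exp_shift _ _ _ _ (fun j jk => (E j jk).2)).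
    by rewrite !exp_shiftD t2 // subrr !exp_shift0 //; lia.
  case: j => [//|[|[|j]]] jk.
  - by rewrite !exp_shift_1 re_ratio1 // im_ratio1.
  - rewrite !exp_shift_2 re_ratio1 // im_ratio1 mulr1 mulr0 addNr add0r.
    by split=> //; rewrite /= wE //; lia.
  rewrite /re_of /im_of wE; last by lia.
  rewrite wE; last by lia.
  rewrite !ifF; try by lia.
  have -> : (2 * j + 3).+2 = (2 * j.+3 - 1)%N by lia.
  have -> : (2 * j + 4).+2 = (2 * j.+3)%N by lia.
  by rewrite (zetaE _ _ _).1 (zetaE _ _ _).2 zeta_oddE zeta_evenE opprK.
apply/rowP => i; rewrite mxE; case: ifP => // ir.
rewrite s1 mul1r /unit_coord.
have [-> ->] := ratio i./2.+1 ltac:(lia).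
have [ao ae] := crd_ratios i./2.+1 a a1.
have crdi : a 0 i = crd a i.+1 by rewrite /crd /= inord_val.
have [io|ie] := boolP (odd i).
  by rewrite crdi -ae; congr crd; lia.
by rewrite crdi -ao; congr crd; lia.
Qed.

Lemma continuous_zeta_section N (w : 'rV[R]_N -> nat -> R) :
  (forall i, elementary setT (w^~ i)) ->
  continuous (fun z => zeta_section (w z)).
Proof.
move=> wel z.
have elc F : elementary setT F -> {for z, continuous F}.
  move=> Fel; apply: differentiable_continuous.
  exact: (elementary_differentiable setT).
apply: continuous_at_mx => i' i; rewrite (ord1 i').
rewrite /prop_for /=; under eq_fun do rewrite mxE.
case: ifP => ir; last exact: (@cst_continuous _ _ (a 0 i) z).
apply: (@continuousM _ _ (fun z => scale_of (w z))
                         (fun z => unit_coord (w z) i)).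
  (* The square root lies outside the class [elementary]; here only its continuity is used. *)
  apply: (@continuous_comp _ _ _ (fun z => w z 0%N / zeta1 mu nu a) Num.sqrt).
    by apply/elc/elementaryM => //; exact: elementary_cst.
  exact: sqrt_continuous.
apply: elc; rewrite /unit_coord.
have cel c := elementary_cst (n := N) setT c.
have tel : elementary setT (fun z => shift_of (w z)).
  by apply: elementaryM => //; apply: elementaryD.
have pel k :
    elementary setT (fun z => exp_shift (shift_of (w z)) (re_of (w z)) k).
  apply: elementary_exp_shift tel _ => -[|[|[|j]]];
    first [exact: cel|exact: wel].
have qel k :
    elementary setT (fun z => exp_shift (shift_of (w z)) (im_of (w z)) k).
  apply: elementary_exp_shift tel _ => -[|[|[|j]]];
    first [exact: cel|exact: wel|exact: elementaryN].
case: odd; [apply: elementaryD|apply: elementaryB]; exact: elementaryM.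
Qed.

End ZetaSection.

Lemma size_zeta_seq (R : realType) r (mu nu : R) : (0 < r)%N ->
  size (zeta_seq r mu nu) = (2 * r - 1)%N.
Proof.
rewrite /zeta_seq; case: eqP => [->//|r1 r0].
by rewrite /= size_map size_iota; lia.
Qed.

Lemma nth_zeta_seq (R : realType) r (mu nu : R) i :
  (0 < r)%N -> (i < 2 * r - 1)%N ->
  nth (fun=> 0) (zeta_seq r mu nu) i =
  zeta mu nu (if i == 0%N then 1%N else i.+2).
Proof.
rewrite /zeta_seq; case: eqP => [->|r1 r0] ir; first by case: i ir.
case: i ir => [//|i] ir /=.
by rewrite (nth_map 0%N) ?nth_iota ?size_iota ?add3n //; lia.
Qed.

Lemma functionally_independent_zeta (R : realType) r (mu nu : R)
    (U : set 'rV[R]_(2 * r).+1) :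
  (0 < r)%N -> nu != 0 -> U `<=` [set x | crd x 1 != 0] ->
  functionally_independent U (zeta_seq r mu nu).
Proof.
move=> r0 nu0 U1; apply: functionally_independent_section => a /U1 a1.
set s := zeta_seq r mu nu; have sz := size_zeta_seq _ _ mu nu r0.
(* The row vector is read as a sequence, extended by 0. *)
pose w (z : 'rV[R]_(size s)) i := if insub i is Some j then z 0 j else 0.
have wE z (i : 'I_(size s)) : w z i = z 0 i by rewrite /w valK.
have wel i : elementary setT (w^~ i).
  rewrite /w; case: insub => [j|]; first exact: elementary_coord.
  exact: elementary_cst.
have wa i : (i < 2 * r - 1)%N ->
    w (tuple_map s a) i = zeta mu nu (if i == 0%N then 1%N else i.+2) a.
  move=> ir; have is_ : (i < size s)%N by rewrite sz.
  by rewrite (wE _ (Ordinal is_)) mxE /= nth_zeta_seq.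
exists (fun z => zeta_section mu nu a (w z)); split.
- exact: continuous_zeta_section.
- exact: zeta_sectionK.
(* zeta_1 is positive at [a], and positivity is an open condition. *)
have w0 : \forall z \near tuple_map s a, 0 < w z 0%N.
  have wc : {for tuple_map s a, continuous (w^~ 0%N)}.
    exact/differentiable_continuous/(elementary_differentiable setT).
  apply: (@cvgr_gt _ _ _ _ _ _ wc); rewrite wa /=; last by lia.
  exact: zeta1_gt0.
apply: filterS w0 => z z0; apply/rowP => i; rewrite mxE -wE.
have ir : (i < 2 * r - 1)%N by rewrite -sz.
by rewrite nth_zeta_seq // zeta_zeta_section.
Qed.

(** * The coadjoint matrix *)

Lemma derive_sum_partial (R : realType) n (F : 'rV[R]_n -> R) (x v : 'rV[R]_n) :
  differentiable F x -> \sum_j v 0 j * partial j F x = 'D_v F x.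
Proof.
move=> Fd; rewrite [in RHS](row_sum_delta v) deriveE // linear_sum.
by apply: eq_bigr => j _; rewrite linearZ /= /partial deriveE.
Qed.

Lemma lt_ord_max n (i : 'I_n.+1) : i != ord_max -> (i < n)%N.
Proof. by move: (ltn_ord i); rewrite -val_eqE /=; lia. Qed.

(** Such a matrix lives on its last row and last column, and is a sum of two matrices of rank at
    most 1. *)
Lemma rank_border_le2 (F : fieldType) n (A : 'M[F]_n.+1) :
  (forall i j, i != ord_max -> j != ord_max -> A i j = 0) ->
  A ord_max ord_max = 0 -> (\rank A <= 2)%N.
Proof.
move=> A0 Amax.
have -> : A = delta_mx ord_max 0 *m row ord_max A +
              col ord_max A *m delta_mx (0 : 'I_1) ord_max.
  apply/matrixP => i j; rewrite !mxE !big_ord1 !mxE eqxx !andbT /=.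
  have [->|i0] := eqVneq i ord_max; have [->|j0] := eqVneq j ord_max;
    by rewrite ?Amax ?mul1r ?mulr1 ?mul0r ?mulr0 ?addr0 ?add0r // A0.
apply: leq_trans (mxrank_add _ _) _; rewrite -[2%N]/(1 + 1)%N.
by apply: leq_add; apply: leq_trans (mxrankM_maxl _ _) (rank_leq_col _).
Qed.

Lemma rank_skew_minor_ge2 (F : fieldType) n (A : 'M[F]_n) (i j : 'I_n) :
  A i i = 0 -> A j j = 0 -> A j i = - A i j -> A i j != 0 -> (2 <= \rank A)%N.
Proof.
move=> Aii Ajj Aji Aij.
pose f (k : 'I_2) := if k == 0 then i else j.
pose B := rowsub f (colsub f A).
(* [B] is skew of size 2, so its square is the scalar [- A i j ^+ 2]. *)
have BB : B *m (- (A i j ^- 2) *: B) = 1%:M.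
  apply/matrixP => k l; rewrite !mxE !big_ord_recl big_ord0 !mxE /f /=.
  case: k l => [[|[|//]] kl] [[|[|//]] ll];
    by rewrite -!val_eqE /= ?Aii ?Ajj ?Aji; field.
have /mulmx1_unit[/mxrank_unit rB _] := BB.
rewrite -[2%N]rB; apply: leq_trans (mxrankS (rowsub_sub _ _)) _.
by rewrite -[in X in colsub _ X](mulmx1 A) -mulmx_colsub; exact: mxrankM_maxl.
Qed.

(** * Elements of the Lie algebra as linear functions on the dual *)

Section StructureConstants.
Context {R : realType} {g : vectType R} {n : nat}.
Variables (br : g -> g -> g) (e : n.-tuple g).
Hypothesis lie_br : lie_bracket br.
Hypothesis e_basis : basis_of fullv e.

Definition eval_at (x : 'rV[R]_n) (y : g) : R := \sum_k coord e k y * x 0 k.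

Lemma eval_at_is_linear x : linear_for *%R (eval_at x).
Proof.
move=> c y z; rewrite /eval_at mulr_sumr -big_split /=.
by apply: eq_bigr => k _; rewrite linearP /= mulrDl mulrA.
Qed.

Lemma eval_at_basis x (i : 'I_n) : eval_at x e`_i = x 0 i.
Proof.
rewrite /eval_at (bigD1 i) //= coord_free ?(basis_free e_basis) // eqxx mul1r.
rewrite big1 ?addr0 // => k ki.
by rewrite coord_free ?(basis_free e_basis) // eq_sym (negbTE ki) mul0r.
Qed.

Lemma bracket_skew y z : br y z = - br z y.
Proof.
have [brl brr br0 _] := lie_br; apply/eqP; rewrite -addr_eq0.
have Dl u u' t : br (u + u') t = br u t + br u' t.
  by have := brr t 1 u u'; rewrite !scale1r.
have Dr u u' t : br t (u + u') = br t u + br t u'.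
  by have := brl t 1 u u'; rewrite !scale1r.
by have := br0 (y + z); rewrite Dl !Dr !br0 add0r addr0 => ->.
Qed.

Lemma coadjoint_mxE x i j : coadjoint_mx br e x i j = eval_at x (br e`_i e`_j).
Proof. by rewrite mxE. Qed.

End StructureConstants.

(** * Coadjoint fields and generic rank for the given algebra *)

Section JordanAlgebra.
Context {R : realType} {r : nat}.
Variables (mu nu : R) (g : vectType R) (br : g -> g -> g).
Variables (e : (2 * r).+1.-tuple g).
Hypothesis r0 : (0 < r)%N.
Hypothesis nu0 : nu != 0.
Hypothesis lie_br : lie_bracket br.
Hypothesis e_basis : basis_of fullv e.
Hypothesis J_br : J_relations br mu nu e.

Let eval_crd x k : (0 < k <= (2 * r).+1)%N -> eval_at e x e`_k.-1 = crd x k.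
Proof.
move=> kr; have kr' : (k.-1 < (2 * r).+1)%N by lia.
by have := eval_at_basis e e_basis x (inord k.-1); rewrite inordK.
Qed.

Let evalD x y z : eval_at e x (y + z) = eval_at e x y + eval_at e x z.
Proof. by have := eval_at_is_linear e x 1 y z; rewrite scale1r mul1r. Qed.

Let evalZ x c y : eval_at e x (c *: y) = c * eval_at e x y.
Proof.
have eval0 : eval_at e x 0 = 0.
  by rewrite /eval_at big1 // => k _; rewrite linear0 mul0r.
by have := eval_at_is_linear e x c y 0; rewrite eval0 !addr0.
Qed.

Let evalN x y : eval_at e x (- y) = - eval_at e x y.
Proof. by rewrite -scaleN1r evalZ mulN1r. Qed.

Let bracket_ideal i j : (i < 2 * r)%N -> (j < 2 * r)%N -> br e`_i e`_j = 0.
Proof. by have [_ _ _ br0] := J_br; move=> ir jr; apply: (br0 i.+1 j.+1). Qed.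

Let ad_row x (i : 'I_(2 * r).+1) := row i (coadjoint_mx br e x).

Let crd_ad_row x i k : (0 < k <= 2 * r)%N ->
  crd (ad_row x i) k = - eval_at e x (br e`_k.-1 e`_i).
Proof.
move=> kr; rewrite /crd mxE coadjoint_mxE inordK; last by lia.
by rewrite bracket_skew // evalN.
Qed.

(** Row [i] holds the values of [e_i, e_j] at [x], that is, the coadjoint field of e_i. *)
Lemma derive_ad_row_zeta x i j : crd x 1 != 0 ->
  (j == 1%N) || (2 < j < (2 * r).+1)%N ->
  'D_(row i (coadjoint_mx br e x)) (zeta mu nu j) x = 0.
Proof.
move=> x1 jr.
have [iM|iM] := eqVneq i ord_max; last first.
  have i2r := lt_ord_max _ _ iM.
  have crd0 k : (0 < k <= 2 * r)%N -> crd (ad_row x i) k = 0.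
    move=> kr; rewrite crd_ad_row // bracket_ideal //; last by lia.
    by rewrite -(scale0r 0) evalZ mul0r oppr0.
  (* The brackets within the abelian ideal vanish, so only the x_n component can be nonzero. *)
  have [] // := is_derive_zeta r mu nu 0 x (ad_row x i) nu0 x1
    _ _ _ j jr.
  - by rewrite crd0 ?mul0r //; lia.
  - by rewrite crd0 ?mul0r //; lia.
  - by move=> k kr; rewrite !crd0 ?mul0r //; lia.
have [br1 br2 brk _] := J_br; rewrite {i}iM.
(* The relations give [e_j, e_n], whereas the row holds [e_n, e_j]; hence the factor -1. *)
have [] // := is_derive_zeta r mu nu (-1) x (ad_row x ord_max) nu0 x1
  _ _ _ j jr.
- rewrite crd_ad_row; last by lia.
  rewrite br1 evalD evalN !evalZ !eval_crd; try by lia.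
  by rewrite mulN1r.
- rewrite crd_ad_row; last by lia.
  rewrite br2 evalD !evalZ !eval_crd; try by lia.
  by rewrite mulN1r.
- move=> k kr; have [bro bre] := brk k kr.
  rewrite !crd_ad_row; try by lia.
  rewrite bro bre !evalD evalN !evalZ !eval_crd; try by lia.
  by rewrite !mulN1r.
Qed.

Lemma invariants_number_J : invariants_number br e = (2 * r - 1)%N.
Proof.
rewrite /invariants_number; suff -> : max_coadjoint_rank br e = 2%N by lia.
have [_ _ br0 _] := lie_br.
have eval0 x : eval_at e x 0 = 0 by rewrite -(scale0r 0) evalZ mul0r.
apply/eqP; rewrite eqn_leq; apply/andP; split.
  apply/bigmax_leqP => k /asboolP[x <-]; apply: rank_border_le2.
    by move=> i j iM jM; rewrite coadjoint_mxE bracket_ideal ?eval0 ?lt_ord_max.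
  by rewrite coadjoint_mxE br0 eval0.
(* At the dual vector of e_2 the bracket [e_1, e_n] takes the nonzero value [- nu]. *)
pose x : 'rV[R]_(2 * r).+1 := delta_mx 0 (inord 1).
have rk2 : (2 <= \rank (coadjoint_mx br e x))%N.
  apply: (rank_skew_minor_ge2 _ _ _ ord0 ord_max); rewrite !coadjoint_mxE.
  - by rewrite br0 eval0.
  - by rewrite br0 eval0.
  - by rewrite bracket_skew // evalN.
  have [br1 _ _ _] := J_br.
  rewrite [br _ _]br1 evalD evalN !evalZ.
  rewrite !eval_crd; try by lia.
  rewrite /crd !mxE /= -!val_eqE /= !inordK; try by lia.
  by rewrite mulr0 mulr1 add0r oppr_eq0.
apply: leq_trans rk2 _.
have rn : (\rank (coadjoint_mx br e x) < (2 * r).+2)%N.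
  by rewrite ltnS rank_leq_row.
apply: (@leq_bigmax_cond _ _ (fun k : 'I_(2 * r).+2 => k : nat) (Ordinal rn)).
by apply/asboolP; exists x.
Qed.

End JordanAlgebra.

Theorem mainTheorem3 (R : realType) (r : nat) (mu nu : R)
    (g : vectType R) (br : g -> g -> g) (e : (2 * r).+1.-tuple g)
    (U : set 'rV[R]_(2 * r).+1) :
  (0 < r)%N -> nu != 0 ->
  lie_bracket br -> basis_of fullv e -> J_relations br mu nu e ->
  open U -> connected U -> U `<=` [set x | crd x 1 != 0] ->
  basis_of_invariants br e U (zeta_seq r mu nu).
Proof.
move=> r0 nu0 lie_br e_basis J_br Uop _ U1; split.
- by rewrite size_zeta_seq // (invariants_number_J mu nu).
- move=> i; rewrite size_zeta_seq // => ir; rewrite nth_zeta_seq //.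
  set j := if _ then _ else _.
  have jr : (j == 1%N) || (2 < j < (2 * r).+1)%N.
    by rewrite /j; case: i ir {j} => [|i] ir //=; lia.
  have Fel : elementary U (zeta (m := 2 * r) mu nu j).
    by apply: elementary_zeta => //; lia.
  split; first exact: elementary_smooth.
  move=> x Ux k.
  have D0 := derive_ad_row_zeta mu nu g br e r0 nu0 lie_br e_basis J_br
    x k j (U1 x Ux) jr.
  (* The invariance equation is the derivative along a row of the coadjoint matrix. *)
  rewrite -[RHS]D0 -derive_sum_partial; last exact: elementary_differentiable Ux.
  by apply: eq_bigr => l _; rewrite !mxE mulr_suml.
- exact: functionally_independent_zeta.
Qed.
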